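(* Let $G$ be a Noetherian group. Then every spectrum $\sigma_G$ of $G$, endowed with the coarse lower topology, is compact.
   Context: A group is Noetherian if all its subgroups are finitely generated (equivalently, it satisfies the ascending chain condition on subgroups). For a group $G$, $\mathrm{N}_G$ denotes the set of all normal subgroups of $G$. A spectrum $\sigma_G$ of $G$ is the set of all normal subgroups of $G$ having some fixed property (e.g. being prime, maximal, primary, principal, finitely generated, proper, ...), with the standing assumption $G\notin\sigma_G$; so it is a set of proper normal subgroups of $G$. For $\mathfrak{x}\in \mathrm{N}_G$ put $\mathcal{V}(\mathfrak{x})=\{\mathfrak{n}\in\sigma_G\mid \mathfrak{x}\subseteq\mathfrak{n}\}$. The coarse lower topology on $\sigma_G$ is the topology for which the sets $\mathcal{V}(\mathfrak{x})$, $\mathfrak{x}\in \mathrm{N}_G$, form a subbasis of closed sets. A spectrum with this topology is called a normal structure space. Compact means every open cover has a finite subcover (no Hausdorff condition). *)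

(* Defs.v *)
From HB Require Import structures.
From mathcomp Require Import all_boot.
From mathcomp Require Import all_classical.
From mathcomp Require Import topology.

Set Implicit Arguments.
Unset Strict Implicit.
Unset Printing Implicit Defensive.

Local Open Scope classical_set_scope.
Local Open Scope group_scope.

Definition subgroups (G : groupType) : set (set G) :=
  [set H | group_closed [in H]].
Arguments subgroups G _ : clear implicits.

Definition normal_subgroups (G : groupType) : set (set G) :=
  [set N | subgroups G N /\ forall x g : G, N x -> N (x ^ g)].
Arguments normal_subgroups G _ : clear implicits.

Definition generated_subgroup (G : groupType) (X : set G) : set G :=
  smallest (subgroups G) X.

Definition finitely_generated (G : groupType) (H : set G) : Prop :=
  exists2 X : set G, finite_set X & H = generated_subgroup X.

Definition noetherian (G : groupType) : Prop :=
  forall H : set G, subgroups G H -> finitely_generated H.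

(* The fixed property selecting the members of a spectrum is arbitrary, so a
   spectrum is an arbitrary (possibly empty) set of proper normal subgroups. *)
Definition spectrum (G : groupType) (sigma : set (set G)) : Prop :=
  sigma `<=` normal_subgroups G /\ ~ sigma [set: G].

(* The points of sigma, as a type of its own: it must not inherit any topology
   from the function type set G. *)
Definition structure_space (G : groupType) (sigma : set (set G)) : Type :=
  set_type sigma.

HB.instance Definition _ (G : groupType) (sigma : set (set G)) :=
  Choice.copy (structure_space sigma) (set_type sigma).

Definition hull (G : groupType) (sigma : set (set G)) (x : set G) :
    set (structure_space sigma) :=
  [set n | x `<=` \val n].
Arguments hull {G} sigma x _.

(* Coarse lower topology: the complements of the sets [hull sigma x], for x a
   normal subgroup, form a subbase of open sets. *)
HB.instance Definition _ (G : groupType) (sigma : set (set G)) :=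
  isSubBaseTopological.Build (structure_space sigma)
    (normal_subgroups G) (fun x : set G => ~` hull sigma x).

(* Main.v *)
Require Import Defs.
From mathcomp Require Import all_boot all_classical topology.
From mathcomp Require Import finmap.

(** Compactness is tested on an ultrafilter [F] of points of [sigma].  The
    elements [g] of [G] that belong to [F]-almost every point form a subgroup
    [H], because the points are subgroups and [F] is stable under finite
    intersections.  As [G] is Noetherian, [H] is generated by finitely many
    elements; each lies in [F]-almost every point, hence so do all of them at
    once, so that [F]-almost every point contains the whole of [H].  In
    particular some point [n] of [sigma] contains [H]
    ([filter_core_sub_point]).

    Such a point is a limit of [F].  If a subbasic open set, the complement of
    [hull sigma N], contains [n], some [g] in [N] is outside [n], hence outside
    [H]: the points that contain [g] do not form a set of [F], so [F] being an
    ultrafilter, the points that avoid [g] do, and these are all outside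
    [hull sigma N]. *)

Local Open Scope classical_set_scope.
Local Open Scope group_scope.

(** The finite sets of indices inside [D], ordered by inclusion, form a filter
    basis along which their partial unions eventually cover a neighbourhood of
    each point of [A]; compactness in its near-covering form makes one finite
    set serve all of [A].  Stated for every topological space, since a
    structure space may be empty and so carries no base point. *)
Lemma compact_cover_compact (T : topologicalType) (A : set T) :
  compact A -> cover_compact A.
Proof.
move=> /compact_near_coveringP cA I D f fo Af.
pose above (E : {fset I}) :=
  [set E' : {fset I} | {subset E <= E'} /\ {subset E' <= D}].
pose F := filter_from [set E : {fset I} | {subset E <= D}] above.
have FF : Filter F.
  apply: filter_from_filter; first by exists fset0 => //= i; rewrite inE.
  move=> E1 E2 /= sE1 sE2; exists (E1 `|` E2)%fset.
    by move=> i /fsetUP[/sE1|/sE2].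
  by move=> E [sE sED]; split; split=> // i iE; apply: sE; apply/fsetUP; tauto.
have FA : \forall E \near F, A `<=` cover [set` E] f.
  apply: (cA _ F (fun E x => cover [set` E] f x) FF) => x /Af [i Di fi_x].
  exists (f i, above [fset i]%fset) => /=.
    split; first exact/open_nbhs_nbhs/(conj (fo i Di) fi_x).
    by exists [fset i]%fset => //= j /fset1P->; exact/mem_set.
  by move=> [y E] /= [fy [sE _]]; exists i => //=; apply: sE; apply/fset1P.
have [E sED aboveE] := FA.
by exists E; last exact: (aboveE E (conj (fun i iE => iE) sED)).
Qed.

(** Convergence need only be tested on the subbase, because a filter is stable
    under finite intersections. *)
Lemma structure_space_cvg (G : groupType) (sigma : set (set G))
    (F : set_system (structure_space sigma)) (n : structure_space sigma) :
  Filter F ->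
  (forall N, normal_subgroups G N -> ~ hull sigma N n -> F (~` hull sigma N)) ->
  F --> n.
Proof.
move=> FF Fhull A; rewrite nbhsE => -[U [[C CB <-] [V CV Vn]] sUA].
rewrite nbhs_filterE; apply: filterS sUA _.
apply: (@filterS _ _ _ V) => [m Vm|]; first by exists V.
have /CB [D sD DV] := CV; rewrite -DV.
apply: filter_bigI => N DN; apply: Fhull; first exact: set_mem (sD _ DN).
by move: Vn; rewrite -DV => /(_ N DN).
Qed.

(** For an ultrafilter [F], the limits of [F] include every point that contains
    this set, which is why it is the only trace of [F] that needs study. *)
Definition filter_core (G : groupType) (sigma : set (set G))
    (F : set_system (structure_space sigma)) : set G :=
  [set g | F [set n | \val n g]].

Lemma subgroupsP (G : groupType) (H : set G) :
  subgroups G H <-> H 1 /\ (forall x y, H x -> H y -> H (x / y)).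
Proof.
split=> -[H1 HV]; split; first exact/set_mem/H1.
- by move=> x y Hx Hy; apply/set_mem/HV; apply/mem_set.
- exact/mem_set.
- by move=> x y /set_mem Hx /set_mem Hy; apply/mem_set/HV.
Qed.

Lemma filter_core_subgroup (G : groupType) (sigma : set (set G))
    (F : set_system (structure_space sigma)) :
  Filter F -> sigma `<=` subgroups G -> subgroups G (filter_core G sigma F).
Proof.
move=> FF sigmaS; apply/subgroupsP; split.
  apply: filterS (@filterT _ F _) => n _.
  by have /subgroupsP[] := sigmaS _ (set_valP n).
move=> x y Fx Fy; apply: filterS (filterI Fx Fy) => n [nx ny].
by have /subgroupsP[_] := sigmaS _ (set_valP n); apply.
Qed.

(** Finite generation enters here: the core being generated by finitely many
    elements, the points that contain it are a finite intersection of sets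
    of [F], and a set of a proper filter is inhabited. *)
Lemma filter_core_sub_point (G : groupType) (sigma : set (set G))
    (F : set_system (structure_space sigma)) :
  noetherian G -> ProperFilter F -> sigma `<=` subgroups G ->
  exists n : structure_space sigma, filter_core G sigma F `<=` \val n.
Proof.
move=> noethG FF sigmaS.
have coreS := filter_core_subgroup G sigma F _ sigmaS.
have [X /finite_fsetP[Y ->] coreE] := noethG _ (coreS _).
have FY : F (\bigcap_(g in [set` Y]) [set n | \val n g]).
  apply: filter_bigI => g Yg.
  suff : filter_core G sigma F g by [].
  by rewrite coreE; apply: sub_gen_smallest.
have [n nY] := filter_ex FY; exists n.
rewrite coreE; apply: smallest_sub; last exact: nY.
exact/sigmaS/set_valP.
Qed.

Theorem theorem3p24 (G : groupType) (sigma : set (set G)) :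
  noetherian G -> spectrum sigma ->
  cover_compact [set: structure_space sigma].
Proof.
move=> noethG [sigmaN _].
have sigmaS : sigma `<=` subgroups G by move=> N /sigmaN[].
apply: compact_cover_compact; rewrite compact_ultra => F FU _.
have [n coren] := filter_core_sub_point G sigma F noethG _ sigmaS.
exists n; split=> //; apply: structure_space_cvg => N _ /existsNP[g].
move=> /not_implyP[Ng nng].
have [Fg|Fng] := in_ultra_setVsetC [set m : structure_space sigma | \val m g] FU.
  by have := coren _ Fg.
by apply: filterS Fng => m /= nmg Nm; apply/nmg/Nm.
Qed.
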